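(* The ordinary generating function for nonnesting permutations that avoid $\{1231,1321,2113\}$ is $$\sum_{n\ge0} c_n(1231,1321,2113)\,x^n=\frac{1+2x-\sqrt{1-8x+4x^2}}{6x}.$$
   Context: A word $\pi=\pi_1\dots\pi_m$ over the positive integers contains the pattern $\sigma=\sigma_1\dots\sigma_k$ if there are indices $1\le i_1<\dots<i_k\le m$ such that for all $r,s\in\{1,\dots,k\}$: $\pi_{i_r}<\pi_{i_s}$ iff $\sigma_r<\sigma_s$, and $\pi_{i_r}=\pi_{i_s}$ iff $\sigma_r=\sigma_s$; otherwise $\pi$ avoids $\sigma$. $\mathcal{C}_n$ denotes the set of nonnesting permutations: arrangements (words) of the multiset $\{1,1,2,2,\dots,n,n\}$ that avoid the patterns $1221$ and $2112$ ($\mathcal{C}_0$ consists of the empty word only). For patterns $\sigma,\tau,\dots$, $c_n(\sigma,\tau,\dots)$ is the number of $\pi\in\mathcal{C}_n$ avoiding all of $\sigma,\tau,\dots$. The identity is one of formal power series in $x$, where the square root denotes the power series with constant term $1$. *)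

(* Defs.v *)
From HB Require Import structures.
From mathcomp Require Import all_boot all_order all_algebra.
From mathcomp Require Import boolp classical_sets.

Set Implicit Arguments.
Unset Strict Implicit.
Unset Printing Implicit Defensive.

Import GRing.Theory.

Notation "x %:F" := (@FracField.tofrac _ x) : ring_scope.

Section Words.
Local Open Scope nat_scope.

Implicit Types (w sigma : seq nat) (B : seq (seq nat)) (n : nat).

Definition contains w sigma : bool :=
  [exists i : {ffun 'I_(size sigma) -> 'I_(size w)},
    [forall r : 'I_(size sigma), forall s : 'I_(size sigma),
      [&& (r < s) ==> (i r < i s),
          (nth 0 w (i r) < nth 0 w (i s)) == (nth 0 sigma r < nth 0 sigma s) &
          (nth 0 w (i r) == nth 0 w (i s)) ==
            (nth 0 sigma r == nth 0 sigma s)]]].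

Definition avoids w sigma : bool := ~~ contains w sigma.

Definition double_letters n : seq nat :=
  flatten [seq [:: k; k] | k <- iota 1 n].

(* [permutations] lists the distinct rearrangements, each exactly once. *)
Definition nonnesting n : seq (seq nat) :=
  [seq w <- permutations (double_letters n) |
    avoids w [:: 1; 2; 2; 1] && avoids w [:: 2; 1; 1; 2]].

Definition c n B : nat := count (fun w => all (avoids w) B) (nonnesting n).

End Words.

Local Open Scope ring_scope.

(* Formal power series; [coefs f n] is the coefficient of x^n. *)
Record fps (R : idomainType) := Fps { coefs : nat -> R }.

Section Fps.
Variable R : idomainType.
Implicit Types f g h : fps R.

Lemma fpsP f g : coefs f =1 coefs g -> f = g.
Proof. by case: f g => [f] [g] /= /funext ->. Qed.

HB.instance Definition _ := gen_eqMixin (fps R).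
HB.instance Definition _ := gen_choiceMixin (fps R).

Definition fps_zero : fps R := Fps (fun=> 0).
Definition fps_opp f : fps R := Fps (fun n => - coefs f n).
Definition fps_add f g : fps R := Fps (fun n => coefs f n + coefs g n).
Definition fps_one : fps R := Fps (fun n => (n == 0)%:R).
Definition fps_mul f g : fps R :=
  Fps (fun n => \sum_(i < n.+1) coefs f i * coefs g (n - i)%N).

Fact fps_addA : associative fps_add.
Proof. by move=> f g h; apply: fpsP => n /=; rewrite addrA. Qed.
Fact fps_addC : commutative fps_add.
Proof. by move=> f g; apply: fpsP => n /=; rewrite addrC. Qed.
Fact fps_add0 : left_id fps_zero fps_add.
Proof. by move=> f; apply: fpsP => n /=; rewrite add0r. Qed.
Fact fps_addN : left_inverse fps_zero fps_opp fps_add.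
Proof. by move=> f; apply: fpsP => n /=; rewrite addNr. Qed.

HB.instance Definition _ := GRing.isZmodule.Build (fps R)
  fps_addA fps_addC fps_add0 fps_addN.

Definition fps_trunc m f : {poly R} := \poly_(i < m.+1) coefs f i.

Lemma coef_fps_trunc m f n : (n <= m)%N -> (fps_trunc m f)`_n = coefs f n.
Proof. by rewrite coef_poly ltnS => ->. Qed.

Lemma coef_fps_truncM m f g n : (n <= m)%N ->
  coefs (fps_mul f g) n = (fps_trunc m f * fps_trunc m g)`_n.
Proof.
move=> le_nm; rewrite coefM; apply: eq_bigr => i _.
have le_in : (i <= n)%N by rewrite -ltnS.
by rewrite !coef_fps_trunc ?(leq_trans _ le_nm) ?leq_subr.
Qed.

Fact fps_mulA : associative fps_mul.
Proof.
move=> f g h; apply: fpsP => n.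
transitivity ((fps_trunc n f * (fps_trunc n g * fps_trunc n h))`_n).
  rewrite coefM; apply: eq_bigr => i _.
  have le_in : (i <= n)%N by rewrite -ltnS.
  by rewrite coef_fps_trunc // (coef_fps_truncM _ _ (leq_subr i n)).
rewrite mulrA coefM; apply: eq_bigr => i _.
have le_in : (i <= n)%N by rewrite -ltnS.
by rewrite coef_fps_trunc ?leq_subr // (coef_fps_truncM _ _ le_in).
Qed.

Fact fps_mulC : commutative fps_mul.
Proof.
by move=> f g; apply: fpsP => n; rewrite !(coef_fps_truncM _ _ (leqnn n)) mulrC.
Qed.

Fact fps_mul1 : left_id fps_one fps_mul.
Proof.
move=> f; apply: fpsP => n /=.
by rewrite big_ord_recl /= mul1r subn0 big1 ?addr0 // => i _; rewrite mul0r.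
Qed.

Fact fps_mulDl : left_distributive fps_mul fps_add.
Proof.
move=> f g h; apply: fpsP => n /=.
by rewrite -big_split; apply: eq_bigr => i _; rewrite mulrDl.
Qed.

Fact fps_one_neq0 : fps_one != 0.
Proof.
apply/eqP => /(congr1 (fun f => coefs f 0%N)) /= /eqP.
by rewrite oner_eq0.
Qed.

HB.instance Definition _ := GRing.Zmodule_isComNzRing.Build (fps R)
  fps_mulA fps_mulC fps_mul1 fps_mulDl fps_one_neq0.

Lemma coefs_fps0 n : coefs (0 : fps R) n = 0. Proof. by []. Qed.
Lemma coefs_fps1 n : coefs (1 : fps R) n = (n == 0)%:R. Proof. by []. Qed.
Lemma coefs_fpsN f n : coefs (- f) n = - coefs f n. Proof. by []. Qed.
Lemma coefs_fpsD f g n : coefs (f + g) n = coefs f n + coefs g n.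
Proof. by []. Qed.
Lemma coefs_fpsM f g n :
  coefs (f * g) n = \sum_(i < n.+1) coefs f i * coefs g (n - i)%N.
Proof. by []. Qed.

Definition fps_unit : {pred fps R} := [pred f | `[< exists g, g * f = 1 >]].
Definition fps_inv f : fps R := xget f [set g | g * f = 1]%classic.

Fact fps_mulVx : {in fps_unit, left_inverse 1 fps_inv *%R}.
Proof.
by move=> f /asboolP ex_g; apply: (@xgetPex _ f [set g | g * f = 1]%classic).
Qed.
Fact fps_unitPl f g : g * f = 1 -> fps_unit f.
Proof. by move=> gf1; apply/asboolP; exists g. Qed.
Fact fps_inv_out : {in [predC fps_unit], fps_inv =1 id}.
Proof.
move=> f /negP nUf; rewrite /fps_inv; case: xgetP => // g _ gf1.
by case: nUf; apply: fps_unitPl gf1.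
Qed.

HB.instance Definition _ := GRing.ComNzRing_hasMulInverse.Build (fps R)
  fps_mulVx fps_unitPl fps_inv_out.

Lemma fps_order f : f != 0 ->
  exists2 a, coefs f a != 0 & forall i, (i < a)%N -> coefs f i = 0.
Proof.
move=> nz_f; have ex_a : exists a, coefs f a != 0.
  apply: contrapT => no_a; case/eqP: nz_f; apply: fpsP => n.
  by apply/eqP/negPn/negP => nz_fn; apply: no_a; exists n.
case: (ex_minnP ex_a) => a nz_fa min_a; exists a => // i lt_ia.
by apply/eqP; apply: contraLR lt_ia => /min_a; rewrite -leqNgt.
Qed.

Fact fps_mulf_eq0 f g : f * g = 0 -> (f == 0) || (g == 0).
Proof.
move=> fg0; apply/norP => -[/fps_order [a nz_fa f_lt] /fps_order [b nz_gb g_lt]].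
have lt_a : (a < (a + b).+1)%N by rewrite ltnS leq_addr.
move/(congr1 (fun h => coefs h (a + b)%N)): fg0.
rewrite coefs_fpsM coefs_fps0 (bigD1 (Ordinal lt_a)) //= addKn big1 ?addr0.
  by move/eqP; rewrite mulf_eq0 (negPf nz_fa) (negPf nz_gb).
move=> i ne_ia; case: (ltngtP i a) => [/f_lt -> | lt_ai | eq_ia].
- by rewrite mul0r.
- by rewrite g_lt ?mulr0 // ltn_subLR ?ltn_add2r // -ltnS.
by case/eqP: ne_ia; apply: val_inj.
Qed.

HB.instance Definition _ := GRing.ComUnitRing_isIntegral.Build (fps R)
  fps_mulf_eq0.

Definition fpsX : fps R := Fps (fun n => (n == 1)%:R).

(* The square root with constant term 1; it exists when [f] has constant term 1
   and 2 is invertible, and is then unique: see [fps_sqrtP], [fps_sqrt_uniq]. *)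
Definition fps_sqrt f : fps R :=
  xget 0 [set s | coefs s 0%N = 1 /\ s ^+ 2 = f]%classic.

End Fps.

Section Sqrt.
Variable F : fieldType.
Hypothesis nz2 : 2 != 0 :> F.
Implicit Types f s : fps F.

Fixpoint fps_sqrt_prefix f n : seq F :=
  if n is m.+1 then
    let s := fps_sqrt_prefix f m in
    rcons s ((coefs f n - \sum_(i < m) s`_i.+1 * s`_(m - i)) / 2)
  else [:: 1].

Lemma size_fps_sqrt_prefix f n : size (fps_sqrt_prefix f n) = n.+1.
Proof. by elim: n => //= n IHn; rewrite size_rcons IHn. Qed.

Lemma nth_fps_sqrt_prefix f m n : (n <= m)%N ->
  (fps_sqrt_prefix f m)`_n = (fps_sqrt_prefix f n)`_n.
Proof.
elim: m => [|m IHm]; first by rewrite leqn0 => /eqP ->.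
rewrite leq_eqVlt ltnS => /predU1P [-> // | le_nm].
by rewrite [LHS]nth_rcons size_fps_sqrt_prefix ltnS le_nm IHm.
Qed.

Lemma fps_sqrt_exists f : coefs f 0%N = 1 ->
  exists s, coefs s 0%N = 1 /\ s ^+ 2 = f.
Proof.
move=> f0; pose a n := (fps_sqrt_prefix f n)`_n.
exists (Fps a); split=> //; apply: fpsP => -[|m].
  by rewrite expr2 coefs_fpsM big_ord1 f0 mulr1.
rewrite expr2 coefs_fpsM big_ord_recl big_ord_recr /= subn0 subnn.
rewrite [a 0%N]/a /= mul1r mulr1.
rewrite /bump leq0n add1n.
have -> : a m.+1 = (coefs f m.+1 - \sum_(i < m)
    (fps_sqrt_prefix f m)`_i.+1 * (fps_sqrt_prefix f m)`_(m - i)) / 2.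
  by rewrite /a /= nth_rcons size_fps_sqrt_prefix ltnn eqxx.
set T := \sum_(i < m) a _ * _; set S := \sum_(i < m) _.
have -> : T = S.
  apply: eq_bigr => i _; rewrite add1n subSS.
  by rewrite !nth_fps_sqrt_prefix ?leq_subr.
by rewrite addrCA -mulr2n -(mulr_natr (_ / _)) divfK // addrC subrK.
Qed.

Lemma fps_sqrtP f : coefs f 0%N = 1 ->
  coefs (fps_sqrt f) 0%N = 1 /\ fps_sqrt f ^+ 2 = f.
Proof.
move=> /fps_sqrt_exists.
exact: (@xgetPex _ 0 [set s | coefs s 0%N = 1 /\ s ^+ 2 = f]%classic).
Qed.

Lemma fps_sqrt_uniq f s :
  coefs s 0%N = 1 -> s ^+ 2 = f -> fps_sqrt f = s.
Proof.
move=> s0 s2f; have [t0 t2f] : coefs (fps_sqrt f) 0%N = 1 /\ fps_sqrt f ^+ 2 = f.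
  by apply: (@xgetPex _ 0 [set s | coefs s 0%N = 1 /\ s ^+ 2 = f]%classic);
    exists s.
move/eqP: t2f; rewrite -s2f eqf_sqr => /predU1P [// | /eqP].
move/(congr1 (fun h => coefs h 0%N)); rewrite coefs_fpsN s2f t0 s0 => /eqP.
by rewrite -subr_eq0 opprK -mulr2n (negPf nz2).
Qed.

End Sqrt.

(* Main.v *)
Require Import Defs.
From mathcomp Require Import all_boot all_order all_algebra.
From mathcomp Require Import zify ring.
Import GRing.Theory.

(** Write a word of the class as [A m B m C], where [m] is its least letter.
    Avoiding 1221, 1231 and 1321 means here that [B] has at most one letter, and
    avoiding 2112 and 2113 means that no letter of [A] is smaller than or equal
    to a letter of [C]; a forbidden subword that does not use [m] already occurs
    in [A B C] ([valid_insert_min]). A letter of [B] has its second copy either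
    in [C] or in [A], and can be moved back to the beginning of [C] or to the
    end of [A]. So the word is obtained from a concatenation of two words of the
    class, a high one and a low one, by inserting the two copies of [m]: both at
    the border, or around the first letter of the low word, or around the last
    letter of the high word. The high letters are all above the low ones, hence
    every choice of two words of the class gives a word of the class
    ([valid_cat]), and the second copy of the letter between the two [m] tells
    which of the cases has occurred ([unjoin]).

    The second insertion requires a nonempty low word and the third a nonempty
    high word, so the generating function satisfies
    [F = 1 + x (F^2 + 2 F (F - 1)) = 1 + x (3 F^2 - 2 F)]
    ([size_good_words_rec], [gf_quadratic]). Then [1 + 2 x - 6 x F] has constant
    term 1 and its square is [1 - 8 x + 4 x^2], which is the claim. *)

Set Implicit Arguments.
Unset Strict Implicit.
Unset Printing Implicit Defensive.
Local Open Scope nat_scope.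

(** * Pattern containment by subsequences *)

(** Comparing letters by [<] alone is enough: on a linear order, agreement of
    [<] in both directions forces agreement of [=]. Beyond the length of the
    pattern nothing is required, so this is meant for words of equal size. *)
Definition same_order (u sigma : seq nat) :=
  forall r s, r < size sigma -> s < size sigma ->
    (nth 0 u r < nth 0 u s) = (nth 0 sigma r < nth 0 sigma s).

Lemma same_order_lt u sigma r s : same_order u sigma ->
  r < size sigma -> s < size sigma ->
  nth 0 sigma r < nth 0 sigma s -> nth 0 u r < nth 0 u s.
Proof. by move=> so lr ls; rewrite so. Qed.

Lemma same_order_eq u sigma r s : same_order u sigma ->
  r < size sigma -> s < size sigma ->
  nth 0 sigma r = nth 0 sigma s -> nth 0 u r = nth 0 u s.
Proof.
move=> so lr ls e; have := so r s lr ls; have := so s r ls lr.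
by rewrite e ltnn; case: ltngtP.
Qed.

(** An increasing list of positions is a filter of the list of all positions,
    and selecting letters commutes with filtering. *)
Lemma subseq_nth_sorted (w p : seq nat) :
  sorted ltn p -> all (gtn (size w)) p -> subseq (map (nth 0 w) p) w.
Proof.
move=> sp ap; rewrite -[X in subseq _ X](mkseq_nth 0 w) /mkseq map_subseq //.
suff -> : p = [seq i <- iota 0 (size w) | i \in p] by apply: filter_subseq.
apply: (irr_sorted_eq ltn_trans ltnn) => // [|i].
  by apply: (sorted_filter ltn_trans); apply: iota_ltn_sorted.
rewrite mem_filter mem_iota add0n leq0n /=.
by case: (boolP (i \in p)) => // /(allP ap) /= ->.
Qed.

Lemma eqn_of_ltn m n p q :
  (m < n) = (p < q) -> (n < m) = (q < p) -> (m == n) == (p == q).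
Proof. by case: (ltngtP m n); case: (ltngtP p q). Qed.

(** Subsequences are easier to cut along a concatenation than functions on
    positions, so all pattern arguments go through this form. *)
Lemma containsP w sigma :
  reflect (exists u, [/\ subseq u w, size u = size sigma & same_order u sigma])
          (contains w sigma).
Proof.
apply: (iffP existsP) => [[i /forallP Hi]|[u [/subseqP[b sb ->] su Hu]]].
  have lti (r s : 'I_(size sigma)) : r < s -> i r < i s.
    by have /forallP/(_ s)/and3P[/implyP] := Hi r.
  exists [seq nth 0 w (i r) | r <- enum 'I_(size sigma)]; split.
  - rewrite (map_comp (nth 0 w) (fun r => i r : nat)).
    apply: subseq_nth_sorted; last by apply/allP => _ /mapP[r _ ->] /=.
    apply: (homo_sorted (e := relpre (@nat_of_ord _) ltn)) => [r s|].
      exact: lti.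
    by rewrite -sorted_map val_enum_ord iota_ltn_sorted.
  - by rewrite size_map size_enum_ord.
  - move=> r s lr ls.
    have e t (lt : t < size sigma) :
        nth 0 [seq nth 0 w (i r) | r <- enum 'I_(size sigma)] t =
        nth 0 w (i (Ordinal lt)).
      rewrite (nth_map (Ordinal lt)) ?size_enum_ord //.
      by congr (nth 0 w (i _)); apply: val_inj; rewrite /= nth_enum_ord.
    rewrite (e _ lr) (e _ ls).
    by have /forallP/(_ (Ordinal ls))/and3P[_ /eqP ->] := Hi (Ordinal lr).
pose p := mask b (iota 0 (size w)).
have pw t : t < size sigma -> nth 0 p t < size w.
  move=> lt; have : nth 0 p t \in p.
    by apply: mem_nth; rewrite size_mask ?size_iota // -(size_mask sb) su.
  by move/mem_mask; rewrite mem_iota.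
have ep : mask b w = map (nth 0 w) p.
  by rewrite map_mask -/(mkseq _ _) mkseq_nth.
have sp : size p = size sigma by rewrite -su ep size_map.
have lp r s : r < s -> s < size sigma -> nth 0 p r < nth 0 p s.
  move=> rs ls; apply: (sorted_ltn_nth ltn_trans) => //; rewrite ?inE ?sp //.
  - by apply: (sorted_mask ltn_trans); apply: iota_ltn_sorted.
  - exact: ltn_trans ls.
exists [ffun r : 'I_(size sigma) => Ordinal (pw r (ltn_ord r))].
apply/forallP => r; apply/forallP => s; rewrite !ffunE /=.
have e t : t < size sigma -> nth 0 w (nth 0 p t) = nth 0 (mask b w) t.
  by move=> lt; rewrite ep (nth_map 0) // sp.
rewrite !e //; apply/and3P; split.
- by apply/implyP => rs; apply: lp.
- by rewrite Hu.
- have := Hu r s (ltn_ord r) (ltn_ord s).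
  have := Hu s r (ltn_ord s) (ltn_ord r).
  by move=> Hsr Hrs; exact: eqn_of_ltn Hrs Hsr.
Qed.

Definition good w :=
  [&& all (avoids w) [:: [:: 1; 2; 3; 1]; [:: 1; 3; 2; 1]; [:: 2; 1; 1; 3]],
    avoids w [:: 1; 2; 2; 1] & avoids w [:: 2; 1; 1; 2]].

(** The five patterns combine into two families. A letter [a], two larger
    letters, then [a] again: according to the order of the two larger letters
    this is 1231, 1321 or 1221. Two copies of [a] between larger letters
    [b <= c]: this is 2113 or 2112. *)
Definition valid w := forall a b c, a < b -> a < c ->
  ~ subseq [:: a; b; c; a] w /\ (b <= c -> ~ subseq [:: b; a; a; c] w).

Lemma goodP w : reflect (valid w) (good w).
Proof.
have avP sigma u : size u = size sigma -> avoids w sigma ->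
   same_order u sigma -> ~ subseq u w.
  by move=> su /containsP av Hu suw; apply: av; exists u.
apply: (iffP idP) => [/and3P[/and4P[a1 a2 a3 _] a4 a5] a b c ab ac|v].
  have [ba ca] : (b < a = false) /\ (c < a = false) by split; lia.
  split=> [|bc].
    case: (ltngtP b c) => bc; last subst c.
    - have cb : c < b = false by lia.
      apply: (avP _ _ _ a1) => // -[|[|[|[|r]]]] [|[|[|[|s]]]] //= _ _;
        by rewrite ?ltnn ?ab ?ac ?bc ?ba ?ca ?cb.
    - have cb : b < c = false by lia.
      apply: (avP _ _ _ a2) => // -[|[|[|[|r]]]] [|[|[|[|s]]]] //= _ _;
        by rewrite ?ltnn ?ab ?ac ?bc ?ba ?ca ?cb.
    - apply: (avP _ _ _ a4) => // -[|[|[|[|r]]]] [|[|[|[|s]]]] //= _ _;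
        by rewrite ?ltnn ?ab ?ba.
  move: bc; rewrite leq_eqVlt => /predU1P[bc|bc].
  - subst c; apply: (avP _ _ _ a5) => // -[|[|[|[|r]]]] [|[|[|[|s]]]] //= _ _;
      by rewrite ?ltnn ?ab ?ba.
  - have cb : c < b = false by lia.
    apply: (avP _ _ _ a3) => // -[|[|[|[|r]]]] [|[|[|[|s]]]] //= _ _;
      by rewrite ?ltnn ?ab ?ac ?bc ?ba ?ca ?cb.
rewrite /good /= andbT; do ![apply/andP; split]; apply/containsP => -[].
all: move=> [|a [|b [|c [|d [|? ?]]]]] [suw //= _ so].
- have /= da := same_order_eq (r := 3) (s := 0) so isT isT erefl.
  have /= ab := same_order_lt (r := 0) (s := 1) so isT isT isT.
  have /= ac := same_order_lt (r := 0) (s := 2) so isT isT isT.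
  by subst d; apply: (v a b c ab ac).1 suw.
- have /= da := same_order_eq (r := 3) (s := 0) so isT isT erefl.
  have /= ab := same_order_lt (r := 0) (s := 1) so isT isT isT.
  have /= ac := same_order_lt (r := 0) (s := 2) so isT isT isT.
  by subst d; apply: (v a b c ab ac).1 suw.
- have /= cb := same_order_eq (r := 2) (s := 1) so isT isT erefl.
  have /= ba := same_order_lt (r := 1) (s := 0) so isT isT isT.
  have /= bd := same_order_lt (r := 1) (s := 3) so isT isT isT.
  have /= ad := same_order_lt (r := 0) (s := 3) so isT isT isT.
  by subst c; apply: (v b a d ba bd).2 (ltnW ad) suw.
- have /= da := same_order_eq (r := 3) (s := 0) so isT isT erefl.
  have /= ab := same_order_lt (r := 0) (s := 1) so isT isT isT.
  have /= ac := same_order_lt (r := 0) (s := 2) so isT isT isT.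
  by subst d; apply: (v a b c ab ac).1 suw.
- have /= cb := same_order_eq (r := 2) (s := 1) so isT isT erefl.
  have /= da := same_order_eq (r := 3) (s := 0) so isT isT erefl.
  have /= ba := same_order_lt (r := 1) (s := 0) so isT isT isT.
  by subst c d; apply: (v b a a ba ba).2 (leqnn a) suw.
Qed.

(** * Words around their least letter *)

Lemma subseq_cons_cat (T : eqType) (x : T) (s t u : seq T) :
  x \notin t -> subseq (x :: s) (t ++ u) = subseq (x :: s) u.
Proof.
elim: t => //= y t IH; rewrite inE negb_or => /andP[/negPf -> xt].
exact: IH.
Qed.

Lemma subseq_rcons_cat (T : eqType) (x : T) (s t u : seq T) :
  x \notin u -> subseq (rcons s x) (t ++ u) = subseq (rcons s x) t.
Proof.
move=> xu; rewrite -subseq_rev rev_rcons rev_cat.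
by rewrite subseq_cons_cat ?mem_rev // -rev_rcons subseq_rev.
Qed.

Lemma subseq_between (T : eqType) (x : T) (s t u v : seq T) :
  x \notin t -> x \notin u -> x \notin v -> x \notin s ->
  subseq (x :: rcons s x) (t ++ x :: u ++ x :: v) = subseq s u.
Proof.
move=> xt xu xv xs; rewrite subseq_cons_cat //= eqxx.
by rewrite -cat_rcons subseq_rcons_cat // -!cats1 subseq_cat2r.
Qed.

(** All occurrences of [x] in the big word are the two displayed ones, so an
    embedding has to send the two [x] there. *)
Lemma subseq_outside (T : eqType) (x y z : T) (t u v : seq T) :
  x \notin t -> x \notin u -> x \notin v -> y != x -> z != x ->
  subseq [:: y; x; x; z] (t ++ x :: u ++ x :: v) = (y \in t) && (z \in v).
Proof.
move=> xt xu xv yx zx.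
have E w : x \notin w ->
    subseq [:: x; x; z] (w ++ x :: u ++ x :: v) = (z \in v).
  move=> xw; rewrite subseq_cons_cat //= eqxx subseq_cons_cat //= eqxx.
  exact: sub1seq.
elim: t xt => [_|w t IH] /=; last first.
  rewrite !inE negb_or => /andP[_ xt].
  by case: eqP => [->|_]; rewrite ?E ?IH.
rewrite (negPf yx); apply/negP => /(subseq_trans (subseq_cons _ _)).
by rewrite subseq_cons_cat //= eqxx -[v]cats0 subseq_cons_cat.
Qed.

Definition below (s t : seq nat) := {in s & t, forall x y, x < y}.

Lemma subseq_valid v w : subseq v w -> valid w -> valid v.
Proof.
move=> vw val a b c ab ac; have [v1 v2] := val a b c ab ac.
by split=> [/subseq_trans|bc /subseq_trans] H; [apply: v1|apply: v2]; auto.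
Qed.

(** A forbidden subword cannot use letters of both factors. In [a b c a] the
    first letter decides: if it lies in [A], so do the larger [b], [c], and
    [a] does not occur in [C]. In [b a a c] with [b <= c] again the first
    letter decides: if it lies in [A], then so does [c], which is no smaller. *)
Lemma valid_cat A C : below C A -> (valid (A ++ C) <-> valid A /\ valid C).
Proof.
move=> CA; split=> [v|[vA vC] a b c ab ac].
  by split; apply: subseq_valid v; rewrite ?prefix_subseq ?suffix_subseq.
split=> [|bc] s.
  case: (boolP (a \in A)) => aA; last first.
    by apply: (vC a b c ab ac).1; rewrite subseq_cons_cat in s.
  have aC : a \notin C by apply/negP => /CA /(_ aA); rewrite ltnn.
  apply: (vA a b c ab ac).1; move: s.
  by rewrite -[[:: a; b; c; a]]/(rcons [:: a; b; c] a) subseq_rcons_cat.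
case: (boolP (b \in A)) => bA; last first.
  by apply: (vC a b c ab ac).2 => //; rewrite subseq_cons_cat in s.
have cC : c \notin C by apply/negP => /CA /(_ bA); lia.
apply: (vA a b c ab ac).2 => //; move: s.
by rewrite -[[:: b; a; a; c]]/(rcons [:: b; a; a] c) subseq_rcons_cat.
Qed.

(** How the two copies of the least letter [m] constrain a word: two letters
    between them make a subword [m b c m], and a letter of [A] that does not
    exceed some letter of [C] makes a subword [b m m c]. A subword avoiding
    [m] lives in [A ++ B ++ C]. *)
Lemma valid_insert_min m A B C :
  {in A ++ B ++ C, forall x, m < x} ->
  valid (A ++ m :: B ++ m :: C) <->
  [/\ valid (A ++ B ++ C), size B <= 1 & below C A].
Proof.
move=> gm.
have nm X : {subset X <= A ++ B ++ C} -> m \notin X.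
  by move=> sX; apply/negP => /sX/gm; rewrite ltnn.
have mA : m \notin A by apply: nm => x; rewrite !mem_cat => ->.
have mB : m \notin B by apply: nm => x; rewrite !mem_cat => ->; rewrite orbT.
have mC : m \notin C by apply: nm => x; rewrite !mem_cat => ->; rewrite !orbT.
split=> [v|[v sB CA] a b c ab ac].
  split.
  - apply: subseq_valid v; apply: cat_subseq => //.
    apply: subseq_trans (subseq_cons _ _); apply: cat_subseq => //.
    exact: subseq_cons.
  - case: B gm mB v {nm} => [|b [|c B]] //= gm mB v; exfalso.
    have mb : m < b by apply: gm; rewrite mem_cat !inE eqxx !orbT.
    have mc : m < c by apply: gm; rewrite mem_cat !inE eqxx !orbT.
    apply: (v m b c mb mc).1.
    by rewrite subseq_cons_cat //= !eqxx sub1seq mem_cat inE eqxx orbT.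
  - move=> c a cC aA; have ma : m < a by apply: gm; rewrite !mem_cat aA.
    have mc : m < c by apply: gm; rewrite !mem_cat cC !orbT.
    rewrite ltnNge; apply/negP => ac.
    by apply: (v m a c ma mc).2 => //; rewrite subseq_outside ?aA //; lia.
(* Forbidden subwords without [m] survive when [m] is filtered out. *)
have E : filter (predC1 m) (A ++ m :: B ++ m :: C) = A ++ B ++ C.
  have f X : m \notin X -> filter (predC1 m) X = X.
    by move=> mX; apply/all_filterP/allP => x /=; apply: contraTneq => ->.
  by rewrite filter_cat /= eqxx filter_cat /= eqxx !f.
have H s : subseq s (A ++ m :: B ++ m :: C) -> m \notin s ->
    subseq s (A ++ B ++ C).
  move=> sw ms; rewrite -E subseq_filter sw andbT; apply/allP => x /=.
  by apply: contraTneq => ->.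
case: (ltngtP a m) => am.
- have naw : a \notin A ++ m :: B ++ m :: C.
    rewrite mem_cat inE mem_cat inE; apply/negP.
    have := gm a; rewrite !mem_cat.
    by move: (a \in A) (a \in B) (a \in C) => [] [] [] //=; lia.
  split=> [|bc] /mem_subseq /(_ a); rewrite !inE eqxx ?orbT => /(_ isT) H';
    by rewrite H' in naw.
- split=> [|bc] /H s; [apply: (v a b c ab ac).1|apply: (v a b c ab ac).2] => //;
    by apply: s; rewrite !inE; lia.
- subst a; split=> [|bc].
    rewrite -[[:: m; b; c; m]]/(m :: rcons [:: b; c] m).
    rewrite subseq_between //; last by rewrite !inE; lia.
    by move=> /size_subseq /leq_trans /(_ sB).
  rewrite subseq_outside // ?neq_ltn ?ab ?ac ?orbT // => /andP[bA cC].
  by have := CA _ _ cC bA; lia.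
Qed.

(** * Rearrangements of a doubled interval *)

Definition twice k n := flatten [seq [:: j; j] | j <- iota k n].

Lemma twiceS k n : twice k n.+1 = [:: k, k & twice k.+1 n].
Proof. by []. Qed.

Lemma twice_cat k i n : i <= n ->
  twice k n = twice k i ++ twice (k + i) (n - i).
Proof.
by move=> le_in; rewrite -flatten_cat -map_cat -iotaD subnKC.
Qed.

Lemma mem_twice k n x : (x \in twice k n) = (k <= x < k + n).
Proof.
elim: n k => [|n IH] k; first by rewrite addn0 in_nil; lia.
by rewrite twiceS !inE IH; lia.
Qed.

Lemma count_twice k n x : count_mem x (twice k n) = (k <= x < k + n).*2.
Proof.
elim: n k => [|n IH] k; first by rewrite addn0 /=; lia.
by rewrite twiceS /= IH; lia.
Qed.

Lemma size_twice k n : size (twice k n) = n.*2.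
Proof. by elim: n k => // n IH k; rewrite twiceS /= IH. Qed.

(** The letters of [C] form an initial segment of the alphabet, whose end [t]
    is one more than the largest letter of [C] ([k] if [C] is empty). Filtering
    both sides by comparison with [t] separates [C] from [A]. *)
Lemma below_perm_twice k n A C : below C A -> perm_eq (A ++ C) (twice k n) ->
  exists2 i, i <= n &
    perm_eq C (twice k i) /\ perm_eq A (twice (k + i) (n - i)).
Proof.
move=> CA peq; pose t := maxn k (\max_(c <- C) c.+1).
have inw x : x \in A ++ C -> k <= x < k + n by rewrite (perm_mem peq) mem_twice.
have Ct c : c \in C -> c < t.
  by move=> cC; rewrite leq_max (@leq_bigmax_seq _ C xpredT succn c) ?orbT.
have le_t x : k <= x -> (forall c, c \in C -> c < x) -> t <= x.
  by move=> kx Cx; rewrite geq_max kx;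
    apply/bigmax_leqP_seq => c cC _; apply: Cx.
have At a : a \in A -> t <= a.
  move=> aA; apply: le_t => [|c cC]; last exact: CA.
  by have /andP[] : k <= a < k + n by apply: inw; rewrite mem_cat aA.
have kt : k <= t by rewrite leq_maxl.
have tn : t <= k + n.
  apply: le_t => [|c cC]; first exact: leq_addr.
  by have /andP[] : k <= c < k + n by apply: inw; rewrite mem_cat cC orbT.
have le_in : t - k <= n by rewrite leq_subLR.
exists (t - k) => //; rewrite subnKC //.
have all_id (P : pred nat) s : {in s, forall x, P x} -> filter P s = s.
  by move=> Ps; apply/all_filterP/allP.
have none (P : pred nat) s : {in s, forall x, ~~ P x} -> filter P s = [::].
  by move=> Ps; apply/eqP; rewrite -(negbK (_ == _)) -has_filter; apply/hasPn.
have := perm_filter (gtn t) peq; have := perm_filter (leq t) peq.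
rewrite (twice_cat k le_in) !filter_cat subnKC //.
have lo x : x \in twice k (t - k) -> x < t by rewrite mem_twice; lia.
have hi x : x \in twice t (n - (t - k)) -> t <= x by rewrite mem_twice; lia.
rewrite (all_id (leq t) A) // (none (leq t) C); last by move=> x /Ct /=; lia.
rewrite (none (leq t) (twice k _)); last by move=> x /lo /=; lia.
rewrite (all_id (leq t) (twice t _)) // (none (gtn t) A); last
  by move=> x /At /=; lia.
rewrite (all_id (gtn t) C) // (all_id (gtn t) (twice k _)) //.
rewrite (none (gtn t) (twice t _)); last by move=> x /hi /=; lia.
by rewrite !cats0.
Qed.

Lemma perm_insert2 (T : eqType) (x : T) A B C s :
  perm_eq (A ++ x :: B ++ x :: C) [:: x, x & s] = perm_eq (A ++ B ++ C) s.
Proof.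
rewrite -[x :: B ++ _]cat1s perm_catCA perm_cons.
by rewrite catA -[x :: C]cat1s perm_catCA perm_cons catA.
Qed.

Lemma count2_split (T : eqType) (x : T) w : count_mem x w = 2 ->
  exists A B C,
    w = A ++ x :: B ++ x :: C /\ [&& x \notin A, x \notin B & x \notin C].
Proof.
have split s n : count_mem x s = n.+1 ->
    exists s1 s2, [/\ s = s1 ++ x :: s2, x \notin s1 & count_mem x s2 = n].
  move=> cs; have xs : x \in s by rewrite -has_pred1 has_count cs.
  exists (take (index x s) s), (drop (index x s).+1 s).
  have e : s = take (index x s) s ++ x :: drop (index x s).+1 s.
    by rewrite -[in X in X :: _](nth_index x xs) -drop_nth ?index_mem //
      cat_take_drop.
  have nx : x \notin take (index x s) s.
    by rewrite in_take_leq ?index_size ?ltnn.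
  split=> //; move: cs; rewrite [in LHS]e count_cat /= eqxx.
  by rewrite (count_memPn nx) => -[].
case/split=> A [D [-> xA /split[B [C [-> xB /count_memPn xC]]]]].
by exists A, B, C; rewrite xA xB xC.
Qed.

Definition good_words k n := [seq w <- permutations (twice k n) | good w].

Lemma good_wordsP k n w :
  reflect (valid w /\ perm_eq w (twice k n)) (w \in good_words k n).
Proof.
by rewrite mem_filter mem_permutations; apply: (iffP andP) => -[/goodP].
Qed.

(** * Inserting the two copies of the least letter *)

(** Inserts the two copies of the least letter [m] around the border between
    the high part [A] and the low part [C]. The tag tells which letter separates
    the copies: none, the first letter of [C], or the last letter of [A]. The
    tag [Some true] is used for nonempty [C] only, and [Some false] for
    nonempty [A] only. *)
Definition join m (t : option bool) (A C : seq nat) :=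
  match t with
  | None => A ++ m :: m :: C
  | Some true => A ++ m :: if C is b :: C' then [:: b, m & C'] else [:: m]
  | Some false => take (size A).-1 A ++ m :: drop (size A).-1 A ++ m :: C
  end.

(** Reads the tag back: the letter [b] between the copies of [m] belongs to the
    part that holds its other copy. *)
Definition unjoin (m : nat) (w : seq nat) : option bool * (seq nat * seq nat) :=
  let A := take (index m w) w in
  let D := drop (index m w).+1 w in
  let B := take (index m D) D in
  let C := drop (index m D).+1 D in
  if B is b :: _ then
    if b \in C then (Some true, (A, B ++ C)) else (Some false, (A ++ B, C))
  else (None, (A, C)).

Lemma unjoin_cat m A B C : m \notin A -> m \notin B ->
  unjoin m (A ++ m :: B ++ m :: C) =
  if B is b :: _ then
    if b \in C then (Some true, (A, B ++ C)) else (Some false, (A ++ B, C))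
  else (None, (A, C)).
Proof.
have cut X Y : m \notin X -> index m (X ++ m :: Y) = size X.
  by move=> mX; rewrite index_cat (negPf mX) /= eqxx addn0.
have dropS X Y : drop (size X).+1 (X ++ m :: Y) = Y.
  by rewrite -cat_rcons drop_size_cat ?size_rcons.
by move=> mA mB; rewrite /unjoin !(cut, dropS, take_size_cat).
Qed.

(** * The recurrence *)

(** The high part has [n - i] distinct letters and the low part has [i]; each
    can lend a letter only if it is nonempty. *)
Definition tags n i : seq (option bool) :=
  None :: nseq (0 < i) (Some true) ++ nseq (i < n) (Some false).

Definition pieces k n i :=
  [seq (t, AC) | t <- tags n i,
     AC <- [seq (A, C) | A <- good_words (k.+1 + i) (n - i),
                         C <- good_words k.+1 i]].

Lemma piecesP k n i t A C :
  reflect [/\ t \in tags n i, A \in good_words (k.+1 + i) (n - i)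
            & C \in good_words k.+1 i]
          ((t, (A, C)) \in pieces k n i).
Proof.
apply: (iffP allpairsP) => [|[? ? ?]].
  by case=> -[t' _] [/= ? /allpairsP[[A' C'] [/= ? ?]] ->] [-> -> ->].
by exists (t, (A, C)); split=> //; apply/allpairsP; exists (A, C).
Qed.

(** The three tags treated at once: a joined word is a word [A ++ C] with two
    copies of [k] inserted around at most one letter, and [unjoin], in the form
    given by [unjoin_cat], recovers the tag and the two parts. A borrowed letter
    has its second copy in the part that lent it and none in the other part. *)
Lemma pieces_shape k n i t A C : i <= n -> (t, (A, C)) \in pieces k n i ->
  exists A' B C', [/\ join k t A C = A' ++ k :: B ++ k :: C',
    A' ++ B ++ C' = A ++ C, size B <= 1, {subset A' <= A} /\ {subset C' <= C} &
    (if B is b :: _ then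
      if b \in C' then (Some true, (A', B ++ C'))
      else (Some false, (A' ++ B, C'))
     else (None, (A', C'))) = (t, (A, C))].
Proof.
move=> le_in /piecesP[tt /good_wordsP[_ pA] /good_wordsP[_ pC]].
case: t tt => [[]|] tt /=.
- case: C pC tt => [|b C] pC tt.
    move: (perm_size pC); rewrite size_twice => /= i0.
    by move: tt; rewrite -(double_inj (i0 : 0.*2 = _)) /= inE mem_nseq andbF.
  exists A, [:: b], C; split=> //.
    by split=> // c cC; rewrite inE cC orbT.
  have := permP pC (pred1 b); rewrite count_twice -cat1s count_cat => cb.
  suff -> : b \in C by [].
  have b1 : count_mem b [:: b] = 1 by rewrite /= eqxx.
  by rewrite -has_pred1 has_count; lia.
- have A0 : A != [::].
    apply: contraTneq tt => A0.
    move: (perm_size pA); rewrite A0 size_twice /= => ni.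
    rewrite /tags; have -> : (i < n) = false by lia.
    by rewrite inE mem_cat !mem_nseq /= andbF.
  case/lastP: A pA A0 => // A b pA _.
  rewrite size_rcons -cats1 take_size_cat // drop_size_cat //.
  exists A, [:: b], C; split=> //; first by rewrite -catA.
    by split=> // a aA; rewrite mem_cat aA.
  suff /negPf -> : b \notin C by [].
  rewrite (perm_mem pC) mem_twice.
  have : b \in rcons A b by rewrite mem_rcons mem_head.
  by rewrite (perm_mem pA) mem_twice; lia.
- by exists A, [::], C; split=> //; split.
Qed.

Lemma pieces_perm k n i A C : i <= n ->
  A \in good_words (k.+1 + i) (n - i) -> C \in good_words k.+1 i ->
  below C A /\ perm_eq (A ++ C) (twice k.+1 n).
Proof.
move=> le_in /good_wordsP[_ pA] /good_wordsP[_ pC]; split.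
  by move=> c a; rewrite (perm_mem pA) (perm_mem pC) !mem_twice; lia.
by rewrite (twice_cat _ le_in) perm_catC perm_cat.
Qed.

Lemma joinK k n i p : i <= n -> p \in pieces k n i ->
  unjoin k (join k p.1 p.2.1 p.2.2) = p.
Proof.
case: p => t [A C] le_in tAC /=.
have [A' [B [C' [-> e _ _ <-]]]] := pieces_shape le_in tAC.
have /piecesP[_ gA gC] := tAC; have [_ pAC] := pieces_perm le_in gA gC.
have : k \notin A' ++ B ++ C' by rewrite e (perm_mem pAC) mem_twice ltnn.
by rewrite !mem_cat !negb_or => /and3P[kA kB _]; rewrite unjoin_cat.
Qed.

Lemma join_good k n i p : i <= n -> p \in pieces k n i ->
  join k p.1 p.2.1 p.2.2 \in good_words k n.+1.
Proof.
case: p => t [A C] le_in tAC /=.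
have [A' [B [C' [-> e sB [sA sC] _]]]] := pieces_shape le_in tAC.
have /piecesP[_ gA gC] := tAC; have [CA pAC] := pieces_perm le_in gA gC.
apply/good_wordsP; rewrite twiceS perm_insert2 e; split=> //.
apply/valid_insert_min.
  by move=> x; rewrite e (perm_mem pAC) mem_twice => /andP[].
rewrite e; split=> //; last by move=> c a /sC cC /sA; apply: CA.
move/good_wordsP: gA => [vA _]; move/good_wordsP: gC => [vC _].
by apply/(valid_cat CA).
Qed.

(** By [valid_insert_min] the word is [A k B k C] with [B] of size at most one
    and [C] below [A]. A letter [b] in [B] has its second copy in [C] or in [A];
    assigned to that part, [b] keeps the low part below the high part, so that
    [below_perm_twice] and [valid_cat] apply. *)
Lemma good_split k n w : w \in good_words k n.+1 ->
  exists2 i, i <= n &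
    exists2 p, p \in pieces k n i & join k p.1 p.2.1 p.2.2 = w.
Proof.
case/good_wordsP; rewrite twiceS => vw pw.
have /count2_split[A [B [C [ew /and3P[kA kB kC]]]]] : count_mem k w = 2.
  by rewrite (permP pw) /= eqxx count_twice ltnn.
subst w; rewrite perm_insert2 in pw.
have gk : {in A ++ B ++ C, forall x, k < x}.
  by move=> x; rewrite (perm_mem pw) mem_twice => /andP[].
have /(valid_insert_min gk)[v sB CA] := vw.
have mk A' C' : A' ++ C' = A ++ B ++ C -> below C' A' ->
   exists2 i, i <= n & [/\ A' \in good_words (k.+1 + i) (n - i),
     C' \in good_words k.+1 i, size A' = (n - i).*2 & size C' = i.*2].
  move=> e CA'; rewrite -e in pw v.
  have [i le_in [pC pA]] := below_perm_twice CA' pw.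
  have [vA vC] := (valid_cat CA').1 v.
  exists i => //; rewrite (perm_size pA) (perm_size pC) !size_twice.
  by split=> //; apply/good_wordsP.
case: B sB v pw mk {vw kB gk} => [|b [|//]] _ v pw mk.
  have [i le_in [gA gC _ _]] := mk A C erefl CA.
  by exists i => //; exists (None, (A, C)) => //; apply/piecesP; rewrite inE.
have cb : count_mem b (A ++ C) = 1.
  have bw : b \in twice k.+1 n.
    by rewrite -(perm_mem pw) !mem_cat mem_head orbT.
  move: (permP pw (pred1 b)); rewrite count_twice -mem_twice bw.
  by rewrite /= !count_cat /= eqxx; lia.
case: (boolP (b \in C)) => bC.
  have CA' : below (b :: C) A.
    by move=> c a; rewrite inE => /predU1P[-> aA|]; apply: CA.
  have [i le_in [gA gC _ sC]] := mk A (b :: C) erefl CA'.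
  exists i => //; exists (Some true, (A, b :: C)) => //.
  apply/piecesP; split=> //; rewrite /tags.
  have -> : 0 < i by move: sC => /=; lia.
  by rewrite !inE.
have bA : b \in A.
  have : b \in A ++ C by rewrite -has_pred1 has_count cb.
  by rewrite mem_cat (negPf bC) orbF.
have CA' : below C (A ++ [:: b]).
  by move=> c a cC; rewrite mem_cat inE => /orP[|/eqP ->]; apply: CA.
have [i le_in [gA gC sA _]] := mk (A ++ [:: b]) C (esym (catA _ _ _)) CA'.
exists i => //; exists (Some false, (A ++ [:: b], C)); last first.
  by rewrite /= size_cat addn1 /= take_size_cat // drop_size_cat.
apply/piecesP; split=> //; rewrite /tags.
have -> : i < n by move: sA; rewrite size_cat /=; lia.
by rewrite inE mem_cat !mem_nseq /= eqxx !orbT.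
Qed.

Lemma uniq_good_words k n : uniq (good_words k n).
Proof. by rewrite filter_uniq ?permutations_uniq. Qed.

Lemma uniq_pieces k n i : uniq (pieces k n i).
Proof.
apply: allpairs_uniq => [||[? ?] [? ?] _ _ [-> ->] //].
  by rewrite /tags; case: (0 < i); case: (i < n).
by apply: allpairs_uniq => [||[? ?] [? ?] _ _ [-> ->] //];
  apply: uniq_good_words.
Qed.

Lemma size_pieces k n i : size (pieces k n i) =
  (1 + (0 < i) + (i < n)) *
  (size (good_words (k.+1 + i) (n - i)) * size (good_words k.+1 i)).
Proof. by rewrite !size_allpairs /= size_cat !size_nseq. Qed.

(** [unjoin] makes the joined words of all pieces pairwise distinct, and
    [join_good] and [good_split] say that they are the good words. *)
Lemma size_good_words_rec k n : size (good_words k n.+1) =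
  \sum_(0 <= i < n.+1) (1 + (0 < i) + (i < n)) *
  (size (good_words (k.+1 + i) (n - i)) * size (good_words k.+1 i)).
Proof.
pose f (i : nat) (p : option bool * (seq nat * seq nat)) :=
  join k p.1 p.2.1 p.2.2.
pose ws := [seq f i p | i <- iota 0 n.+1, p <- pieces k n i].
have -> : size (good_words k n.+1) = size ws.
  apply/perm_size/uniq_perm.
  - exact: uniq_good_words.
  - apply: allpairs_uniq_dep => [|i _|]; [exact: iota_uniq|exact: uniq_pieces|].
    move=> ? ? /allpairsPdep[i [p [iI pP ->]]].
    move=> /allpairsPdep[j [q [jI qP ->]]] /= e.
    move: iI jI; rewrite !mem_iota !ltnS => /= iI jI.
    have pq : p = q by rewrite -(joinK iI pP) -(joinK jI qP); congr unjoin.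
    (* The index is half the length of the low part. *)
    subst q; suff -> : i = j by [].
    case: p pP qP {e} => t [A C] /piecesP[_ _ /good_wordsP[_ pC]].
    case/piecesP=> _ _ /good_wordsP[_ /perm_size].
    by rewrite (perm_size pC) !size_twice => /double_inj.
  move=> w; apply/idP/allpairsPdep => [/good_split[i iI [p pP <-]]|].
    by exists i, p; rewrite mem_iota ltnS.
  move=> [i [p [iI pP ->]]]; apply: join_good pP.
  by rewrite mem_iota ltnS in iI.
rewrite size_allpairs_dep sumnE big_map unlock /index_iota subn0.
by elim: (iota _ _) => //= i s ->; rewrite size_pieces.
Qed.

(** Translation of the alphabet does not matter; rather than relabelling words,
    note that the recurrence above determines the sizes and is the same for all
    [k]. *)
Lemma size_good_words k n : size (good_words k n) = size (good_words 1 n).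
Proof.
elim/ltn_ind: n k => -[|n] IH k; first by rewrite /good_words.
rewrite !size_good_words_rec; apply: eq_big_nat => i /andP[_ le_in].
have le_subn : n - i < n.+1 by rewrite ltnS leq_subr.
by rewrite !(IH (n - i) le_subn (_ + i)) !(IH i le_in _.+1).
Qed.

(** * The generating function *)

Local Open Scope ring_scope.

Definition patterns := [:: [:: 1; 2; 3; 1]; [:: 1; 3; 2; 1]; [:: 2; 1; 1; 3]]%N.

Lemma c_size n : c n patterns = size (good_words 1 n).
Proof.
by rewrite /c /nonnesting /good_words -size_filter -filter_predI.
Qed.

Lemma c_patterns0 : c 0 patterns = 1%N.
Proof.
rewrite c_size; suff -> : good_words 1 0 = [:: [::]] by [].
rewrite /good_words /=; case: goodP => // -[] a b c _ _.
by split.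
Qed.

Lemma c_patterns_rec n : c n.+1 patterns =
  (\sum_(i < n.+1) (1 + (0 < i) + (i < n)) *
     (c i patterns * c (n - i) patterns))%N.
Proof.
rewrite c_size size_good_words_rec big_mkord; apply: eq_bigr => i _.
rewrite !c_size (size_good_words (2 + i)%N) (size_good_words 2).
by rewrite [(size _ * size _)%N]mulnC.
Qed.

Lemma coefs_natM (k n : nat) (f : fps rat) :
  coefs (k%:R * f) n = k%:R * coefs f n.
Proof.
elim: k => [|k IH]; first by rewrite !mul0r.
by rewrite -!natr1 !mulrDl !mul1r coefs_fpsD IH.
Qed.

Lemma coefs_fpsXM (f : fps rat) n :
  coefs (fpsX rat * f) n = if n is n'.+1 then coefs f n' else 0.
Proof.
rewrite coefs_fpsM; case: n => [|n]; first by rewrite big_ord1 mul0r.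
rewrite 2!big_ord_recl /= mul0r add0r mul1r subn1 big1 ?addr0 // => i _.
by rewrite mul0r.
Qed.

Definition gf : fps rat := Fps (fun n => (c n patterns)%:R).

(** A pair of parts of sizes [n - i] and [i] is joined in three ways, of which
    one is lost when the low part is empty and one when the high part is. *)
Lemma gf_quadratic : gf = 1 + fpsX rat * (3%:R * (gf * gf) - 2%:R * gf).
Proof.
apply: fpsP => n; rewrite coefs_fpsD coefs_fpsXM.
case: n => [|n]; first by rewrite addr0 /= c_patterns0.
rewrite coefs_fps1 add0r coefs_fpsD coefs_fpsN !coefs_natM coefs_fpsM /=.
rewrite c_patterns_rec natr_sum.
(* The weight 1 + [0 < i] + [i < n] is 3 minus the corrections at the two ends
   of the range, each of which contributes c_n as c_0 = 1. *)
have -> : 2%:R * (c n patterns)%:R =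
    \sum_(i < n.+1) (((i == 0%N :> nat) + (i == n :> nat))%N
       * (c i patterns * c (n - i) patterns))%:R :> rat.
  under eq_bigr do rewrite mulnDl natrD.
  rewrite big_split /= big_ord_recl big_ord_recr /= !eqxx !mul1n subn0 subnn.
  rewrite c_patterns0 mul1n muln1 !big1 => [|i _|i _].
  - by rewrite addr0 add0r -mulr2n mulr_natl.
  - by rewrite (ltn_eqF (ltn_ord i)) mul0n.
  - by rewrite mul0n.
rewrite mulr_sumr -sumrB; apply: eq_bigr => i _.
rewrite -natrM -[3 * _]natrM; apply/eqP.
rewrite eq_sym subr_eq -natrD; apply/eqP; congr (_%:R).
rewrite -mulnDl; congr (_ * _)%N.
by have := ltn_ord i; lia.
Qed.

(* The identity is stated in the field of fractions of the integral domain
   Q[[x]], in which division by 6x makes sense. *)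
Theorem theorem3p34 :
  let X := fpsX rat in
  (Fps (fun n =>
     (c n [:: [:: 1; 2; 3; 1]; [:: 1; 3; 2; 1]; [:: 2; 1; 1; 3]]%N)%:R : rat))%:F
  = (1 + 2 * X - fps_sqrt (1 - 8 * X + 4 * X ^+ 2))%:F / (6 * X)%:F
  :> {fraction fps rat}.
Proof.
move=> X; rewrite -/gf.
(* Completing the square in the quadratic equation: 1 + 2X - 6X gf squares to
   the discriminant and has constant term 1. *)
have -> : fps_sqrt (1 - 8 * X + 4 * X ^+ 2) = 1 + 2 * X - 6 * X * gf.
  apply: fps_sqrt_uniq => //.
    rewrite coefs_fpsD coefs_fpsN coefs_fpsD -mulrA !coefs_natM coefs_fpsXM.
    by rewrite /= !mulr0 subr0 addr0.
  have -> : (1 + 2 * X - 6 * X * gf) ^+ 2 = 1 - 8 * X + 4 * X ^+ 2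
      + 12 * X * (1 + X * (3%:R * (gf * gf) - 2%:R * gf) - gf) by ring.
  by rewrite -gf_quadratic subrr mulr0 addr0.
have -> : 1 + 2 * X - (1 + 2 * X - 6 * X * gf) = gf * (6 * X) by ring.
rewrite rmorphM mulfK // tofrac_eq0.
apply/eqP => /(congr1 (fun f => coefs f 1)).
by rewrite coefs_natM.
Qed.
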